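(* Let $X$ be a real Hilbert space, let $A,B$ be maximally monotone operators on $X$, let $\Gamma\subseteq\mathbb{R}_{++}$ be nonempty, and for $\gamma\in\Gamma$ let $T_\gamma:=\mathrm{Id}-J_{\gamma A}+J_{\gamma B}R_{\gamma A}$. For $\gamma,\delta\in\Gamma$ define $Q_{\delta\gets\gamma}\colon X\to X$ by $$Q_{\delta\gets\gamma}:=\tfrac{\delta}{\gamma}\mathrm{Id}+\bigl(1-\tfrac{\delta}{\gamma}\bigr)J_{\gamma A}.$$ Then $(Q_{\delta\gets\gamma})_{\gamma,\delta\in\Gamma}$ defines fixed-point relocators for $(T_\gamma)_{\gamma\in\Gamma}$ with Lipschitz constants $\mathcal{L}_{\delta\gets\gamma}=\max\{1,\tfrac{\delta}{\gamma}\}$.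
   Context: $\mathbb{R}_{++}$ is the set of positive reals. $J_A=(\mathrm{Id}+A)^{-1}$ is the resolvent of $A$ and $R_A=2J_A-\mathrm{Id}$. $\operatorname{Fix}T=\{x:Tx=x\}$. Fixed-point relocators: given a nonempty set $\Gamma\subseteq\mathbb{R}_{++}$ and a family $(T_\gamma)_{\gamma\in\Gamma}$ of operators from $X$ to $X$, a family of operators $(Q_{\delta\gets\gamma})_{\gamma,\delta\in\Gamma}$ on $X$ defines fixed-point relocators for $(T_\gamma)_{\gamma\in\Gamma}$ with Lipschitz constants $(\mathcal{L}_{\delta\gets\gamma})_{\gamma,\delta\in\Gamma}$ in $[1,+\infty[$ if: (a) for all $\gamma,\delta\in\Gamma$, $Q_{\delta\gets\gamma}|_{\operatorname{Fix}T_\gamma}$ is a bijection from $\operatorname{Fix}T_\gamma$ to $\operatorname{Fix}T_\delta$; (b) for all $\gamma\in\Gamma$ and $x\in\operatorname{Fix}T_\gamma$, the map $\Gamma\to X\colon\delta\mapsto Q_{\delta\gets\gamma}x$ is continuous; (c) for all $\gamma,\delta,\varepsilon\in\Gamma$ and $x\in\operatorname{Fix}T_\gamma$, $Q_{\varepsilon\gets\delta}Q_{\delta\gets\gamma}x=Q_{\varepsilon\gets\gamma}x$; (d) for all $\gamma,\delta\in\Gamma$, $Q_{\delta\gets\gamma}$ is $\mathcal{L}_{\delta\gets\gamma}$-Lipschitz continuous. *)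

(* Defs.v *)
From HB Require Import structures.
From mathcomp Require Import all_boot all_order all_algebra.
From mathcomp Require Import sesquilinear.
From mathcomp Require Import all_classical all_reals all_analysis.

Set Implicit Arguments.
Unset Strict Implicit.
Unset Printing Implicit Defensive.

Import Order.TTheory GRing.Theory Num.Theory.
Import numFieldNormedType.Exports.

Local Open Scope classical_set_scope.
Local Open Scope ring_scope.

(* A real Hilbert space is a [completeNormedModType R] together with an inner
   product [ip] satisfying [induces_norm ip]. *)
Definition induces_norm (R : realType) (X : normedModType R)
    (ip : {dot X for @idfun R}) : Prop :=
  forall x : X, `|x| ^+ 2 = ip x x.

(* Set-valued operators on X have type [X -> set X]; [A x u] reads u \in A x. *)

Definition monotone_op (R : realType) (X : normedModType R)
    (ip : {dot X for @idfun R}) (A : X -> set X) : Prop :=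
  forall x y u v : X, A x u -> A y v -> 0 <= ip (x - y) (u - v).

Definition maximally_monotone (R : realType) (X : normedModType R)
    (ip : {dot X for @idfun R}) (A : X -> set X) : Prop :=
  monotone_op ip A /\
  forall B : X -> set X, monotone_op ip B -> (forall x, A x `<=` B x) -> B = A.

Definition id_op (X : Type) : X -> set X := fun x => [set x].

Definition add_op (X : zmodType) (A B : X -> set X) : X -> set X :=
  fun x => [set u + v | u in A x & v in B x].

Definition scale_op (R : pzRingType) (X : lmodType R) (g : R)
    (A : X -> set X) : X -> set X :=
  fun x => [set g *: u | u in A x].

Definition inv_op (X : Type) (A : X -> set X) : X -> set X :=
  fun u => [set x | A x u].

(* (Id + A)^-1 as a function. When A is maximally monotone this relation is
   single-valued with full domain (Minty), so the default 0 is never used. *)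
Definition resolvent (X : zmodType) (A : X -> set X) : X -> X :=
  fun_of_rel (fun=> 0) (inv_op (add_op (@id_op X) A)).

Definition reflected_resolvent (R : pzRingType) (X : lmodType R)
    (A : X -> set X) : X -> X :=
  fun x => (2 : R) *: resolvent A x - x.

Definition Fix (X : Type) (T : X -> X) : set X := [set x | T x = x].

(* Families indexed by Gamma are total functions on R of which only the values
   at points of Gamma matter; [Q d g] is Q_{d <- g} and [L d g] is L_{d <- g}. *)
Record fixed_point_relocators (R : realType) (X : normedModType R)
    (Gamma : set R) (T : R -> X -> X) (Q : R -> R -> X -> X)
    (L : R -> R -> R) : Prop := FixedPointRelocators {
  relocator_const_ge1 : forall g d, Gamma g -> Gamma d -> 1 <= L d g ;
  relocator_bij : forall g d, Gamma g -> Gamma d ->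
    set_bij (Fix (T g)) (Fix (T d)) (Q d g) ;
  relocator_continuous : forall g x, Gamma g -> Fix (T g) x ->
    {within Gamma, continuous (fun d => Q d g x)} ;
  relocator_semigroup : forall g d e x, Gamma g -> Gamma d -> Gamma e ->
    Fix (T g) x -> Q e d (Q d g x) = Q e g x ;
  relocator_lipschitz : forall g d, Gamma g -> Gamma d ->
    (L d g).-lipschitz (Q d g)
}.

Definition DR_op (R : pzRingType) (X : lmodType R) (A B : X -> set X) (g : R) :
    X -> X :=
  fun x => x - resolvent (scale_op g A) x
           + resolvent (scale_op g B) (reflected_resolvent (scale_op g A) x).

Definition DR_relocator (R : unitRingType) (X : lmodType R) (A : X -> set X)
    (d g : R) : X -> X :=
  fun x => (d / g) *: x + (1 - d / g) *: resolvent (scale_op g A) x.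

(* Main.v *)
Require Import Defs.
From mathcomp Require Import all_boot all_order all_algebra.
From mathcomp Require Import sesquilinear.
From mathcomp Require Import all_classical all_reals all_analysis.
From mathcomp Require Import ring lra.

Set Implicit Arguments.
Unset Strict Implicit.
Unset Printing Implicit Defensive.

Import Order.TTheory GRing.Theory Num.Theory.
Import numFieldNormedType.Exports.

Local Open Scope classical_set_scope.
Local Open Scope ring_scope.

(** Everything rests on one description of the relocator. Put
    [y = J_{gA} x]; then [Q_{d<-g} x = y + (d/g) (x - y)], and since
    [(Q_{d<-g} x - y) / d = (x - y) / g] lies in [A y], the resolvent
    [J_{dA}] sends [Q_{d<-g} x] to the same point [y]
    ([resolvent_relocator]). Relocating thus keeps the shadow [y] and rescales
    the residual [x - y] by [d/g]. The semigroup law follows on all of X, and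
    [Q_{g<-d}] is a two-sided inverse of [Q_{d<-g}]. In the same terms, [x] is
    fixed by [T_g] exactly when [(y - x) / g] lies in [B y] ([Fix_DR_op]); the
    rescaling leaves this vector unchanged, so fixed points go to fixed points.
    The Lipschitz bound is the firm nonexpansiveness of [J_{gA}] put into the
    expansion of [|r z + (1 - r) p|^2], where [z = x - y], [p] is the difference
    of the resolvents at [x] and [y], and [r = d/g].

    These arguments need [J_{gA}] to be defined everywhere, which is Minty's
    theorem ([minty]). After a translation and a scaling it says that a
    maximally monotone [A] has some [x] with [- x] in [A x]. The proof follows
    Simons and Zalinescu. Let [F] be the Fitzpatrick function of [A],
    [F (x, u) = sup (<x, b> + <a, u> - <a, b>)] over the graph points [(a, b)],
    and minimise [G = F + |.|^2 / 2] over the product of X with itself.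
    Maximality gives [F (x, u) >= <x, u>], hence [G >= |x + u|^2 / 2 >= 0].
    Strong convexity makes minimising sequences Cauchy, so a minimiser
    [(x, u)] exists ([energy_minimizer]), and strengthens minimality to
    [min G <= G w - |w - (x, u)|^2 / 2]. At a graph point [w = (a, b)], where
    [F w = <a, b>], this rearranges to
    [|x + u|^2 <= <- u - a, - x - b>]. By maximality [(- u, - x)] is then a
    graph point; taking it for [(a, b)] gives [x = - u]. *)

(** * The inner product *)

Section InnerProduct.
Variables (R : realType) (X : normedModType R) (ip : {dot X for @idfun R}).
Hypothesis ip_norm : induces_norm ip.
Implicit Types (x y z : X) (k : R).

Lemma ipC x y : ip x y = ip y x.
Proof. by rewrite hermC expr0 mul1r. Qed.

Lemma ipDl x y z : ip (x + y) z = ip x z + ip y z.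
Proof. exact: linearDl. Qed.

Lemma ipDr x y z : ip x (y + z) = ip x y + ip x z.
Proof. exact: linearDr. Qed.

Lemma ipNl x y : ip (- x) y = - ip x y.
Proof. exact: linearNl. Qed.

Lemma ipNr x y : ip x (- y) = - ip x y.
Proof. exact: linearNr. Qed.

Lemma ipZl k x y : ip (k *: x) y = k * ip x y.
Proof. exact: linearZl_LR. Qed.

Lemma ipZr k x y : ip x (k *: y) = k * ip x y.
Proof. exact: linearZr_LR. Qed.

Definition ipE := (ipDl, ipDr, ipNl, ipNr, ipZl, ipZr).

Lemma ip_ge0 x : 0 <= ip x x.
Proof. by rewrite -ip_norm sqr_ge0. Qed.

Lemma ip_eq0 x : ip x x <= 0 -> x = 0.
Proof.
rewrite -ip_norm => x_le0; apply/eqP; rewrite -normr_eq0 -sqrf_eq0.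
by rewrite eq_le x_le0 sqr_ge0.
Qed.

(** Polarization writes the inner product through the norm, which transfers
    the continuity of the norm to it. *)
Lemma ip_polarization x y : ip x y = (`|x + y| ^+ 2 - `|x - y| ^+ 2) / 4.
Proof. by rewrite !ip_norm !ipE (ipC y x); field. Qed.

Lemma cvg_ip (T : Type) (F : set_system T) (FF : ProperFilter F)
    (f g : T -> X) x y :
  f @ F --> x -> g @ F --> y -> (fun t => ip (f t) (g t)) @ F --> ip x y.
Proof.
have cvg_norm2 h z : h @ F --> z -> (fun t => `|h t| ^+ 2) @ F --> `|z| ^+ 2.
  by move=> hz; under eq_fun do rewrite expr2; apply: cvgM; exact: cvg_norm.
move=> fx gy; rewrite ip_polarization.
under eq_fun do rewrite ip_polarization.
apply: cvgM; last exact: cvg_cst.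
by apply: cvgB; apply: cvg_norm2; [exact: cvgD|exact: cvgB].
Qed.

End InnerProduct.

(** Any two terms [n] and [k] are compared directly, which is the form in which
    the midpoint inequality controls a minimising sequence. *)
Lemma cvg_of_dist_harmonic (R : realType) (X : completeNormedModType R)
    (x : nat -> X) (C : R) :
  (forall n k, `|x n - x k| ^+ 2 <= C * (harmonic n + harmonic k)) ->
  cvg (x @ \oo).
Proof.
move=> x_dist; apply: cauchy_cvg; apply: cauchy_exP => e e_gt0.
have [N _ N_small] :
    \forall n \near \oo, C * (harmonic n + harmonic n) < e ^+ 2.
  have : (fun n => C * (harmonic n + harmonic n)) @ \oo --> C * (0 + 0 : R).
    by apply: cvgM; [exact: cvg_cst|apply: cvgD; exact: cvg_harmonic].
  by rewrite addr0 mulr0 => /cvgr_lt; apply; rewrite exprn_gt0.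
exists (x N); exists N => // n /= N_le_n.
rewrite -ball_normE /= -(ltr_pXn2r (n := 2)) ?nnegrE ?normr_ge0 ?ltW //.
apply: le_lt_trans (x_dist N n) _.
move: (N_small N (leqnn N)) (N_small n N_le_n) => /=.
set a := N.+1%:R^-1; set b := n.+1%:R^-1; rewrite !mulrDr; lra.
Qed.

(** * Minty's theorem *)

(** The usable form of maximality: a pair monotonically related to the graph
    belongs to it. In this form maximality passes to translates and positive
    multiples of [A] by a mere change of variables. *)
Definition maximal_graph (R : realType) (X : normedModType R)
    (ip : {dot X for @idfun R}) (A : X -> set X) : Prop :=
  forall x u, (forall a b, A a b -> 0 <= ip (x - a) (u - b)) -> A x u.

(** Otherwise adding [(x, u)] to the graph of [A] would be a proper monotone
    extension. *)
Lemma maximally_monotone_graph (R : realType) (X : normedModType R)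
    (ip : {dot X for @idfun R}) (A : X -> set X) :
  maximally_monotone ip A -> maximal_graph ip A.
Proof.
move=> [monoA maxA] x u xu_rel.
pose B y := A y `|` [set v | y = x /\ v = u].
suff -> : A = B by right.
apply/esym/maxA => [y z v w|y v Ayv]; last by left.
move=> [Ayv|[-> ->]] [Azw|[-> ->]].
- exact: monoA.
- by rewrite -opprB -(opprB u) ipNl ipNr opprK; exact: xu_rel.
- exact: xu_rel.
- by rewrite !subrr linear0r.
Qed.

Section Energy.
Variables (R : realType) (X : completeNormedModType R).
Variable ip : {dot X for @idfun R}.
Hypothesis ip_norm : induces_norm ip.
Variable A : X -> set X.

(** [G], the Fitzpatrick function of [A] plus half the squared norm, is the
    supremum of [energy a b] over the graph points [(a, b)]. *)
Definition energy (a b x u : X) : R :=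
  ip x b + ip a u - ip a b + (ip x x + ip u u) / 2.

(** This says [G (x, u) <= v]. Working with upper bounds avoids the extended
    values that the supremum [G] may take. *)
Definition energy_ub (v : R) (x u : X) : Prop :=
  forall a b, A a b -> energy a b x u <= v.

(** Each [energy a b] is an affine function plus half the squared norm, so its
    convexity defect along a segment is the same quadratic for all [(a, b)]. *)
Lemma energy_segment (a b x u y w : X) (t : R) :
  energy a b (x + t *: (y - x)) (u + t *: (w - u)) =
  (1 - t) * energy a b x u + t * energy a b y w
  - t * (1 - t) / 2 * (ip (x - y) (x - y) + ip (u - w) (u - w)).
Proof.
rewrite /energy !(ipE ip) (ipC ip y x) (ipC ip w u).
by field.
Qed.

Lemma energy_ub_segment (v v' : R) (x u y w : X) (t : R) :
  0 <= t <= 1 -> energy_ub v x u -> energy_ub v' y w ->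
  energy_ub ((1 - t) * v + t * v'
             - t * (1 - t) / 2 * (ip (x - y) (x - y) + ip (u - w) (u - w)))
            (x + t *: (y - x)) (u + t *: (w - u)).
Proof.
move=> /andP[t_ge0 t_le1] ub_v ub_v' a b Aab.
rewrite energy_segment lerB // lerD // ler_wpM2l ?subr_ge0 //.
  exact: ub_v.
exact: ub_v'.
Qed.

Hypothesis A_mono : monotone_op ip A.
Hypothesis A_max : maximal_graph ip A.

(** Monotonicity bounds the Fitzpatrick function by [<a, b>] at a point
    [(a, b)] of the graph. *)
Lemma energy_ub_graph (a b : X) : A a b ->
  energy_ub (ip a b + (ip a a + ip b b) / 2) a b.
Proof.
move=> Aab c d Acd; rewrite lerD2r.
by have := A_mono Aab Acd; rewrite !(ipE ip); lra.
Qed.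

(** The Fitzpatrick function dominates the duality pairing: a point of the
    graph may be used in the supremum, and a point outside it fails to be
    monotonically related to some graph point, by maximality. *)
Lemma energy_ub_ge (v : R) (x u : X) : energy_ub v x u ->
  ip x u + (ip x x + ip u u) / 2 <= v.
Proof.
move=> ub_v.
have [a [b [Aab le0]]] : exists a b, A a b /\ ip (x - a) (u - b) <= 0.
  have [Axu|nAxu] := pselect (A x u).
    by exists x, u; rewrite !subrr linear0r.
  apply: contrapT => no_ab; apply: nAxu; apply: A_max => a b Aab.
  rewrite leNgt; apply/negP => lt0; apply: no_ab.
  by exists a, b; split=> //; exact: ltW.
by have := ub_v a b Aab; move: le0; rewrite /energy !(ipE ip); lra.
Qed.

Lemma energy_ub_ge0 (v : R) (x u : X) : energy_ub v x u -> 0 <= v.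
Proof.
move=> /energy_ub_ge; have := ip_ge0 ip_norm (x + u).
by rewrite !(ipE ip) (ipC ip u x); lra.
Qed.

(** Against an empty graph every pair is monotonically related. *)
Lemma maximal_graph_nonempty : exists a b, A a b.
Proof.
apply: contrapT => no_ab; apply: (no_ab); exists 0, 0; apply: A_max => a b Aab.
by case: no_ab; exists a, b.
Qed.

Lemma cvg_energy (x u : nat -> X) (x0 u0 a b : X) :
  x @ \oo --> x0 -> u @ \oo --> u0 ->
  (fun n => energy a b (x n) (u n)) @ \oo --> energy a b x0 u0.
Proof.
move=> xx0 uu0; apply: cvgD.
  apply: cvgB; last exact: cvg_cst.
  by apply: cvgD; apply: (cvg_ip ip_norm) => //; exact: cvg_cst.
apply: cvgM; last exact: cvg_cst.
by apply: cvgD; apply: (cvg_ip ip_norm).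
Qed.

(** Points with [G] within [1 / (n + 1)] of the infimum [m] form a Cauchy
    sequence: [G] is at least [m] at the midpoint of two of them, while the
    segment inequality puts it below their average by an eighth of their
    squared distance. *)
Lemma energy_minimizer : exists m x u, energy_ub m x u /\
  forall v y w, energy_ub v y w -> m <= v.
Proof.
pose V := [set v | exists x u, energy_ub v x u].
have [a [b Aab]] := maximal_graph_nonempty.
have V_lb : has_lbound V.
  by exists 0 => v [x [u]]; exact: energy_ub_ge0.
have V_inf : has_inf V.
  by split=> //; exists (ip a b + (ip a a + ip b b) / 2), a, b;
     exact: energy_ub_graph.
set m := inf V.
have m_le v y w : energy_ub v y w -> m <= v.
  by move=> ub; apply: ge_inf => //; exists y, w.
have near_min (n : nat) : exists z : X * X, energy_ub (m + harmonic n) z.1 z.2.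
  have [v [x [u ub]] v_lt] := inf_adherent (harmonic_gt0 n) V_inf.
  by exists (x, u) => c d Acd; apply: le_trans (ub c d Acd) (ltW v_lt).
have [z z_ub] := choice near_min.
have z_dist n k : ip ((z n).1 - (z k).1) ((z n).1 - (z k).1)
    + ip ((z n).2 - (z k).2) ((z n).2 - (z k).2)
    <= 4 * (harmonic n + harmonic k).
  have half01 : 0 <= (2^-1 : R) <= 1 by lra.
  have := m_le _ _ _ (energy_ub_segment half01 (z_ub n) (z_ub k)).
  rewrite /=; set p := n.+1%:R^-1; set q := k.+1%:R^-1; lra.
have /cvg_ex [/= x zx] : cvg ((fun n => (z n).1) @ \oo).
  apply: (@cvg_of_dist_harmonic _ _ _ 4) => n k; rewrite ip_norm.
  by apply: le_trans (z_dist n k); rewrite lerDl ip_ge0.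
have /cvg_ex [/= u zu] : cvg ((fun n => (z n).2) @ \oo).
  apply: (@cvg_of_dist_harmonic _ _ _ 4) => n k; rewrite ip_norm.
  by apply: le_trans (z_dist n k); rewrite lerDr ip_ge0.
exists m, x, u; split=> // c d Acd.
have m_lim : (fun n : nat => m + harmonic n) @ \oo --> m + 0.
  by apply: cvgD; [exact: cvg_cst|exact: cvg_harmonic].
rewrite -[leRHS]addr0.
apply: (ler_cvg_to (cvg_energy zx zu) m_lim); near=> n; exact: z_ub.
Unshelve. all: by end_near.
Qed.

(** The point is read off a minimiser [(x, u)] of [G], which turns out to
    satisfy [x + u = 0]. *)
Lemma exists_opp_mem : exists x, A x (- x).
Proof.
have [m [x [u [ub_m m_min]]]] := energy_minimizer.
have key a b : A a b -> ip (x + u) (x + u) <= ip (- u - a) (- x - b).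
  move=> Aab.
  (* [G] exceeds its minimum at the graph point [(a, b)] by half the squared
     distance to the minimiser. *)
  suff : m <= ip a b + (ip a a + ip b b) / 2
              - (ip (x - a) (x - a) + ip (u - b) (u - b)) / 2.
    have := energy_ub_ge ub_m.
    rewrite !(ipE ip) (ipC ip a x) (ipC ip b u) (ipC ip u x); lra.
  set D := ip (x - a) (x - a) + _; set g := ip a b + _.
  (* Comparing with the point at parameter [t] on the segment to [(a, b)] and
     dividing by [t]; the bound sought is the limit at [t = 0]. *)
  have step t : 0 < t <= 1 -> m <= g - (1 - t) / 2 * D.
    move=> /andP[t_gt0 t_le1].
    have t01 : 0 <= t <= 1 by rewrite ltW.
    have := m_min _ _ _ (energy_ub_segment t01 ub_m (energy_ub_graph Aab)).
    rewrite -/D -/g => m_le; rewrite -(ler_pM2l t_gt0); move: m_le; lra.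
  have lim : (fun n : nat => g - (1 - harmonic n) / 2 * D) @ \oo
      --> g - (1 - 0) / 2 * D.
    apply: cvgB; first exact: cvg_cst.
    apply: cvgM; last exact: cvg_cst.
    apply: cvgM; last exact: cvg_cst.
    by apply: cvgB; [exact: cvg_cst|exact: cvg_harmonic].
  have -> : g - D / 2 = g - (1 - 0) / 2 * D by field.
  rewrite -(cvg_lim _ lim)//.
  apply: limr_ge; first by apply: cvgP lim.
  near=> n; apply: step; rewrite harmonic_gt0 /=.
  by rewrite invf_le1 ?ler1n ?ltr0n.
have Aux : A (- u) (- x).
  by apply: A_max => a b Aab; apply: le_trans (key _ _ Aab); exact: ip_ge0.
exists (- u).
have /(ip_eq0 ip_norm)/eqP : ip (x + u) (x + u) <= 0.
  by apply: le_trans (key _ _ Aux) _; rewrite !subrr linear0r.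
by rewrite addr_eq0 => /eqP xE; rewrite xE in Aux.
Unshelve. all: by end_near.
Qed.

End Energy.

(** * Resolvents and relocators *)

Section Resolvent.
Variables (R : realType) (X : completeNormedModType R).
Variable ip : {dot X for @idfun R}.
Hypothesis ip_norm : induces_norm ip.

(** Surjectivity of [Id + gA], with [x = y + g w] solved for [w] in [A y]. It is
    [exists_opp_mem] for the operator [g A - x], which is monotone and maximal
    along with [A]. *)
Lemma minty (A : X -> set X) (x : X) (g : R) :
  0 < g -> maximally_monotone ip A -> exists y, A y (g^-1 *: (x - y)).
Proof.
move=> g_gt0 maxA; have [A_mono _] := maxA.
have A_max := maximally_monotone_graph maxA.
pose C : X -> set X := fun y => [set v | A y (g^-1 *: (v + x))].
have C_mono : monotone_op ip C.
  move=> y z u v Cyu Czv; have := A_mono _ _ _ _ Cyu Czv.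
  rewrite -scalerBr opprD addrACA subrr addr0 ipZr pmulr_rge0 ?invr_gt0 //.
have C_max : maximal_graph ip C.
  move=> y u yu_rel; apply: A_max => a b Aab.
  have : C a (g *: b - x) by rewrite /C /= subrK scalerA mulVf ?scale1r ?gt_eqF.
  move/yu_rel; rewrite opprB addrA -(pmulr_rge0 _ (x := g^-1)) ?invr_gt0 //.
  by rewrite -ipZr scalerBr scalerA mulVf ?scale1r // gt_eqF.
have [y Cy] := exists_opp_mem ip_norm C_mono C_max.
by exists y; rewrite addrC.
Qed.

Variable A : X -> set X.
Hypothesis A_maxmono : maximally_monotone ip A.

Let J g := resolvent (scale_op g A).

(** Minty's theorem provides a value and monotonicity makes it unique. *)
Lemma resolventP (g : R) (x y : X) : 0 < g ->
  J g x = y <-> A y (g^-1 *: (x - y)).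
Proof.
move=> g_gt0; have g_neq0 : g != 0 by rewrite gt_eqF.
have memE z : inv_op (add_op (@id_op X) (scale_op g A)) x z
    <-> A z (g^-1 *: (x - z)).
  split=> [[_ -> [_ [w Azw <-] <-]]|Az].
    by rewrite addrC addKr scalerA mulVf ?scale1r.
  exists z => //; exists (x - z); last by rewrite addrC subrK.
  by exists (g^-1 *: (x - z)) => //; rewrite scalerA mulfV ?scale1r.
split=> [<-|Ay].
  apply/memE; apply: xgetPex; have [z Az] := minty x g_gt0 A_maxmono.
  by exists z; apply/memE.
apply: xget_unique => [|z /memE Az]; first exact/memE.
apply/eqP; rewrite -subr_eq0; apply/eqP/(ip_eq0 ip_norm).
have [A_mono _] := A_maxmono; have := A_mono _ _ _ _ Az Ay.
rewrite -scalerBr ipZr pmulr_rge0 ?invr_gt0 // !(ipE ip); lra.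
Qed.

Lemma resolvent_graph (g : R) (x : X) : 0 < g ->
  A (J g x) (g^-1 *: (x - J g x)).
Proof. by move=> g_gt0; apply/resolventP. Qed.

Lemma resolvent_firmly_nonexpansive (g : R) (x y : X) : 0 < g ->
  ip (J g x - J g y) (J g x - J g y) <= ip (J g x - J g y) (x - y).
Proof.
move=> g_gt0; have [A_mono _] := A_maxmono.
have := A_mono _ _ _ _ (resolvent_graph x g_gt0) (resolvent_graph y g_gt0).
rewrite -scalerBr ipZr pmulr_rge0 ?invr_gt0 //.
rewrite !(ipE ip); lra.
Qed.

Lemma relocator_shift (d g : R) (x : X) :
  DR_relocator A d g x = J g x + (d / g) *: (x - J g x).
Proof. by rewrite /DR_relocator scalerBl scale1r scalerBr addrCA. Qed.

(** Relocation preserves the shadow: the residual [x - J g x] is multiplied by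
    [d / g], so dividing it by [d] gives the same element of [A (J g x)]. *)
Lemma resolvent_relocator (d g : R) (x : X) : 0 < d -> 0 < g ->
  J d (DR_relocator A d g x) = J g x.
Proof.
move=> d_gt0 g_gt0; apply/resolventP => //; rewrite relocator_shift.
rewrite addrC addKr scalerA mulrA mulVf ?gt_eqF // mul1r.
exact: resolvent_graph.
Qed.

Lemma relocator_comp (g d e : R) (x : X) : 0 < g -> 0 < d ->
  DR_relocator A e d (DR_relocator A d g x) = DR_relocator A e g x.
Proof.
move=> g_gt0 d_gt0; rewrite relocator_shift resolvent_relocator //.
rewrite !relocator_shift.
by rewrite [_ + _ - _]addrC addKr scalerA mulrA divfK ?gt_eqF.
Qed.

Lemma relocator_id (g : R) (x : X) : 0 < g -> DR_relocator A g g x = x.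
Proof.
by move=> g_gt0; rewrite relocator_shift divff ?gt_eqF // scale1r addrC subrK.
Qed.

(** With [z = x - y], [p = J g x - J g y] and [r = d / g], firm nonexpansiveness
    gives [<p, p> <= <p, z>]. The difference
    [max(1, r)^2 |z|^2 - |r z + (1 - r) p|^2] is then written, in each of the
    cases [r <= 1] and [r > 1], as [|1 - r|] times a combination of nonnegative
    terms. *)
Lemma relocator_lipschitz_max (d g : R) : 0 < d -> 0 < g ->
  (Num.max 1 (d / g)).-lipschitz (DR_relocator A d g).
Proof.
move=> d_gt0 g_gt0 [x y] _ /=; rewrite /DR_relocator.
set r := d / g; have r_gt0 : 0 < r by rewrite divr_gt0.
have := resolvent_firmly_nonexpansive x y g_gt0.
set p := _ - _ => /= firm.
have -> : r *: x + (1 - r) *: J g x -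
    (r *: y + (1 - r) *: J g y)
    = r *: (x - y) + (1 - r) *: p.
  by rewrite opprD addrACA !scalerBr.
move: p (x - y) firm => p z firm.
have max_gt0 : 0 < Num.max 1 r by rewrite lt_max ltr01.
rewrite -(ler_pXn2r (n := 2)) ?nnegrE ?mulr_ge0 ?normr_ge0 ?(ltW max_gt0) //.
rewrite exprMn !ip_norm.
have := ip_ge0 ip_norm (z - p); have := ip_ge0 ip_norm p.
rewrite !(ipE ip) (ipC ip z p); move: firm.
set a := ip z z; set b := ip p z; set c := ip p p => firm c_ge0 ac.
have [r_le1|r_gt1] := leP r 1.
  have h1 : 0 <= r * (a + c - 2 * b) by apply: mulr_ge0; lra.
  have : 0 <= (1 - r) * (r * (a + c - 2 * b) + (a - c)) by apply: mulr_ge0; lra.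
  lra.
have h1 : 0 <= r * (b - c) by apply: mulr_ge0; lra.
have h2 : 0 <= (r + 1) * c by apply: mulr_ge0; lra.
have : 0 <= (r - 1) * (2 * (r * (b - c)) + (r + 1) * c) by apply: mulr_ge0; lra.
lra.
Qed.

End Resolvent.

(** With [y = J_{gA} x], being fixed means [J_{gB} (2 y - x) = y], and
    [(2 y - x) - y = y - x]. *)
Lemma Fix_DR_op (R : realType) (X : completeNormedModType R)
    (ip : {dot X for @idfun R}) (A B : X -> set X) (g : R) (x : X) :
  induces_norm ip -> maximally_monotone ip B -> 0 < g ->
  let y := resolvent (scale_op g A) x in
  Fix (DR_op A B g) x <-> B y (g^-1 *: (y - x)).
Proof.
move=> ip_norm B_maxmono g_gt0 y.
have -> : y - x = reflected_resolvent (scale_op g A) x - y.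
  by rewrite /reflected_resolvent -/y scaler_nat mulr2n addrAC addrK.
rewrite -(resolventP ip_norm B_maxmono _ _ g_gt0) /Fix /DR_op /= -/y.
split=> [fix_x|->]; last by rewrite subrK.
by apply: (addrI (x - y)); rewrite fix_x subrK.
Qed.

(** Both the shadow [y] and the vector [(y - x) / g] of [Fix_DR_op] are
    unchanged by relocation. *)
Lemma relocator_Fix (R : realType) (X : completeNormedModType R)
    (ip : {dot X for @idfun R}) (A B : X -> set X) (g d : R) (x : X) :
  induces_norm ip -> maximally_monotone ip A -> maximally_monotone ip B ->
  0 < g -> 0 < d ->
  Fix (DR_op A B g) x -> Fix (DR_op A B d) (DR_relocator A d g x).
Proof.
move=> ip_norm A_maxmono B_maxmono g_gt0 d_gt0.
move=> /(Fix_DR_op A x ip_norm B_maxmono g_gt0) By.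
apply/(Fix_DR_op A _ ip_norm B_maxmono d_gt0).
rewrite (resolvent_relocator ip_norm) // relocator_shift opprD addNKr.
by rewrite -scalerN opprB scalerA mulrA mulVf ?gt_eqF // mul1r.
Qed.

Theorem lemma4p7 (R : realType) (X : completeNormedModType R)
    (ip : {dot X for @idfun R}) (ip_norm : induces_norm ip)
    (A B : X -> set X)
    (A_maxmono : maximally_monotone ip A)
    (B_maxmono : maximally_monotone ip B)
    (Gamma : set R) (Gamma_neq0 : Gamma !=set0)
    (Gamma_gt0 : Gamma `<=` [set g | 0 < g]) :
  fixed_point_relocators Gamma (DR_op A B) (DR_relocator A)
    (fun d g => Num.max 1 (d / g)).
Proof.
split.
- by move=> g d _ _; rewrite le_max lexx.
- move=> g d /Gamma_gt0/= g_gt0 /Gamma_gt0/= d_gt0; split.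
  + by move=> x; exact: (relocator_Fix ip_norm).
  + move=> x y _ _ /(congr1 (DR_relocator A g d)).
    by rewrite !(relocator_comp ip_norm) // !relocator_id.
  + move=> y fix_y; exists (DR_relocator A g d y).
      exact: (relocator_Fix ip_norm).
    by rewrite (relocator_comp ip_norm) // relocator_id.
- move=> g x _ _; apply: continuous_subspaceT => d.
  have cvg_ratio : (fun e : R => e / g) @ d --> d / g.
    by apply: cvgM; [exact: cvg_id|exact: cvg_cst].
  apply: cvgD; apply: cvgZ; try exact: cvg_cst; first exact: cvg_ratio.
  by apply: cvgB; [exact: cvg_cst|exact: cvg_ratio].
- move=> g d e x /Gamma_gt0/= g_gt0 /Gamma_gt0/= d_gt0 _ _.
  exact: (relocator_comp ip_norm).
- move=> g d /Gamma_gt0/= g_gt0 /Gamma_gt0/= d_gt0.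
  exact: (relocator_lipschitz_max ip_norm).
Qed.
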